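(* Let $\epsilon\in(0,1)$ and let $\ell\ge 0$ be an integer. Set $$m=\left\lceil \log_2\!\left(\left\lceil 175\left(\ln(10/\epsilon)+1\right)^2\right\rceil+1\right)\right\rceil+1,\qquad N=2^{\ell+m},\qquad K=2^{m-1}-1 .$$ Then the largest eigenvalue $\lambda_{\max}$ of the $N\times N$ DPSS kernel $C_{N,K}$ satisfies $\lambda_{\max}\ge 1-\epsilon$. Equivalently, the DPSS taper $\phi$ (a unit eigenvector of $C_{N,K}$ for $\lambda_{\max}$) has average success probability $\bar P_K(\phi)\ge 1-\epsilon$, i.e. the tapered phase-estimation procedure with this taper outputs one of the $2K+1=2^m-1$ grid estimates $k/N$ closest to the true phase with average probability at least $1-\epsilon$.
   Context: For $N\in\mathbb N$, a taper is a unit vector $\phi=(\phi[0],\dots,\phi[N-1])\in\mathbb C^N$, with discrete-time Fourier transform $\hat\phi(f)=N^{-1/2}\sum_{n=0}^{N-1}\phi[n]e^{2\pi i n f}$ for $f\in\mathbb R$. For an integer $K\ge0$ with $2K+1\le N$ and $\Delta\in\mathbb R$, the success probability is $P_{K,\Delta}(\phi)=\sum_{j=-K}^{K}|\hat\phi(\Delta+j/N)|^2$, and the average success probability is $\bar P_K(\phi)=N\int_{-1/(2N)}^{1/(2N)}P_{K,\Delta}(\phi)\,d\Delta$ (the expectation over $\Delta$ uniform on $[-\tfrac1{2N},\tfrac1{2N}]$). The DPSS kernel $C_{N,K}$ is the real symmetric $N\times N$ matrix indexed by $m,n\in\{0,\dots,N-1\}$ with $C_{N,K}[m,n]=\frac{\sin(\pi(m-n)(2K+1)/N)}{\pi(m-n)}$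 for $m\ne n$ and $C_{N,K}[m,m]=(2K+1)/N$. Here $\ln$ is the natural logarithm. *)

(* Defs.v *)
From HB Require Import structures.
From mathcomp Require Import all_boot all_order all_algebra.
From mathcomp Require Import all_classical all_reals all_analysis.
Set Implicit Arguments. Unset Strict Implicit. Unset Printing Implicit Defensive.
Import Order.TTheory GRing.Theory Num.Theory.
Local Open Scope ring_scope.

Definition dpss_kernel (R : realType) (N K : nat) : 'M[R]_N :=
  \matrix_(i < N, j < N)
    if i == j then (2 * K + 1)%:R / N%:R
    else sin (pi * ((i : nat)%:R - (j : nat)%:R) * (2 * K + 1)%:R / N%:R)
         / (pi * ((i : nat)%:R - (j : nat)%:R)).

(* A = ceil(175 (ln(10/eps) + 1)^2) as a natural number (it is positive). *)
Definition paramA (R : realType) (eps : R) : nat :=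
  `| Num.ceil (175 * (ln (10 / eps) + 1) ^+ 2) |%N.

(* m = ceil(log2(A + 1)) + 1;  up_log 2 n is the least e with n <= 2^e. *)
Definition param_m (R : realType) (eps : R) : nat :=
  (up_log 2 (paramA eps).+1).+1.

(* Main.v *)
Require Import Defs.
From HB Require Import structures.
From mathcomp Require Import all_boot all_order all_algebra.
From mathcomp Require Import all_classical all_reals all_analysis.
From mathcomp Require Import complex ring lra zify.
Import Order.TTheory GRing.Theory Num.Theory.
Import numFieldNormedType.Exports.
Set Implicit Arguments. Unset Strict Implicit. Unset Printing Implicit Defensive.
Local Open Scope ring_scope.
Local Open Scope classical_set_scope.
Local Open Scope sesquilinear_scope.

(* The quadratic form of the DPSS kernel at [v] is the energy of the
   trigonometric polynomial [sum_n v_n e^(2 pi i n f)] in the band [|f| <= W],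
   [W = (2 K + 1) / (2 N)], so it suffices to exhibit one concentrated [v].
   For [N = r M], take the coefficients of [(1 + X + ... + X^(M-1))^r].  By
   Jordan's inequality its spectral density is at most [(2 f)^(- 2 r)], so the
   energy outside the band is at most [(N / (2 K + 1))^(2 r - 1)], while by
   Cauchy-Schwarz the total energy is at least [M^(2 r) / N].  The relative loss
   [r^(2 r) / (2 K + 1)^(2 r - 1)] is below [eps] for [r = 2^(m - 2)], since
   then [2 r <= 2 K + 1] and [2^(r - 1) >= 1 / eps]. *)

(** * Rayleigh quotients of real symmetric matrices *)

(** Diagonalise [A] over [R[i]], where it is hermitian with real spectrum: the quadratic form
    becomes a sum of eigenvalues weighted by squared moduli of coordinates. If all eigenvalues were
    below [c], the form would be strictly below [c] times the squared norm. *)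
Lemma symmetric_rayleigh_eigenvalue (R : rcfType) n (A : 'M[R]_n) (v : 'rV[R]_n)
    (c : R) :
  A^T = A -> v != 0 -> c * (v *m v^T) 0 0 <= (v *m A *m v^T) 0 0 ->
  exists2 lam, eigenvalue A lam & c <= lam.
Proof.
move=> symA v_neq0 c_le.
pose f := real_complex R.
pose B := map_mx f A; pose u := map_mx f v.
have uT : u ^t* = map_mx f v^T.
  by apply/matrixP => i j; rewrite !mxE; exact: conjc_real.
have hermB : B \is hermsymmx.
  apply/is_hermitianmxP; rewrite scale1r; apply/matrixP => i j.
  by rewrite !mxE -[in LHS]symA mxE; apply/esym/conjc_real.
have := hermitian_spectral_diag_real hermB.
have := orthomx_spectralP (hermitian_normalmx hermB).
have := spectral_unitarymx B; have := spectral_unit B.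
set P := spectralmx B; set d := spectral_diag B.
move=> unitP unitaryP BE /mxOverP realD.
have dE i : d 0 i = f (complex.Re (d 0 i)) by rewrite /f RRe_real.
have PB : P *m B = diag_mx d *m P by rewrite BE !mulmxA mulmxV // mul1mx.
(* Row [i] of [P] is an eigenvector of [B]; its eigenvalue is real, so it descends to [A]. *)
have eig i : eigenvalue A (complex.Re (d 0 i)).
  rewrite -(eigenvalue_map f) /= -/f -dE;
  apply/eigenvalueP; exists (row i P).
    by rewrite -row_mul PB row_mul row_diag_mx -scalemxAl -rowE.
  apply/negP => /eqP r0; have : row i P *m invmx P = 0 by rewrite r0 mul0mx.
  rewrite -row_mul mulmxV // => /rowP /(_ i); rewrite !mxE eqxx => /eqP.
  by rewrite oner_eq0.
apply: contrapT => noeig.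
have lt_c i : complex.Re (d 0 i) < c.
  rewrite ltNge; apply/negP => le_c.
  by apply: noeig; exists (complex.Re (d 0 i)).
(* [w] holds the coordinates of [u] in the orthonormal eigenbasis formed by the rows of [P]. *)
have [w wE] : exists w, w = u *m P ^t* by exists (u *m P ^t*).
have wP : w *m P = u.
  by rewrite wE -mulmxA -invmx_unitary // mulVmx ?mulmx1.
have uE : u ^t* = P ^t* *m w ^t* by rewrite -wP trmx_mul map_mxM.
have w_neq0 : w != 0.
  apply: contraNneq v_neq0 => w0; rewrite -(map_mx_eq0 f) -/u -wP w0 mul0mx //.
have normE : f ((v *m v^T) 0 0) = \sum_i `|w 0 i| ^+ 2.
  have -> : f ((v *m v^T) 0 0) = (w *m w ^t*) 0 0.
    have -> : w *m w ^t* = u *m u ^t*.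
      by rewrite uE mulmxA -wE.
    by rewrite uT -map_mxM [in RHS]mxE.
  by rewrite mxE; apply: eq_bigr => i _; rewrite !mxE normCK.
have quadE : f ((v *m A *m v^T) 0 0) = \sum_i d 0 i * `|w 0 i| ^+ 2.
  have -> : f ((v *m A *m v^T) 0 0) = (w *m diag_mx d *m w ^t*) 0 0.
    have -> : w *m diag_mx d *m w ^t* = u *m B *m u ^t*.
      have -> : u *m B = w *m diag_mx d *m P by rewrite -wP -!mulmxA PB.
      by rewrite uE -(mulmxA _ P) (mulmxA P) (unitarymxP unitaryP) mul1mx.
    by rewrite uT -!map_mxM [in RHS]mxE.
  rewrite mxE; apply: eq_bigr => i _.
  by rewrite mul_mx_diag !mxE normCK mulrCA mulrA.
suff : f ((v *m A *m v^T) 0 0) < f (c * (v *m v^T) 0 0).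
  by rewrite ltcR ltNge c_le.
rewrite [ltRHS](rmorphM (real_complex R)) /= -/f normE quadE mulr_sumr.
have [i0 wi0] : exists i, w 0 i != 0.
  apply: contrapT => /forallNP w0; case/negP: w_neq0; apply/eqP/rowP => i.
  by rewrite mxE; apply/eqP; have /negP := w0 i; rewrite negbK.
rewrite (bigD1 i0) //= [ltRHS](bigD1 i0) //=; apply: ltr_leD.
  by rewrite ltr_pM2r ?exprn_gt0 ?normr_gt0 // dE ltcR.
by apply: ler_sum => i _; rewrite ler_wpM2r ?exprn_ge0 // dE lecR ltW.
Qed.

(** * Decay of trigonometric polynomials *)

(* The chord slopes of [sin] on [0, x] and [x, pi / 2] are [cos c] and [cos d]
   with [c <= d], so the former dominates the latter. *)
Lemma jordan_sin (R : realType) (x : R) :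
  0 <= x <= pi / 2 -> 2 * x <= pi * sin x.
Proof.
case/andP => x_ge0 x_le; have pi0 := pi_gt0 R.
have cont (a b : R) : {within `[a, b], continuous (@sin R)}.
  exact/continuous_subspaceT/continuous_sin.
have [c c_itv] := MVT_segment x_ge0 (fun y _ => is_derive_sin y) (cont 0 x).
have [d d_itv] :=
  MVT_segment x_le (fun y _ => is_derive_sin y) (cont x (pi / 2)).
rewrite sin_pihalf sin0 !subr0 => dE cE.
move: c_itv d_itv; rewrite !in_itv /= => /andP[c_ge c_le] /andP[d_ge d_le].
have cos_le : cos d <= cos c.
  have [->//|cd] := eqVneq c d.
  by rewrite ltW // ltr_cos ?in_itv /= ?lt_neqAle ?cd /=; lra.
(* Comparing the slopes with denominators cleared covers both endpoints; the product equals
   [pi / 2 * sin x - x]. *)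
have : 0 <= x * (pi / 2 - x) * (cos c - cos d) by rewrite !mulr_ge0 ?subr_ge0.
have -> : x * (pi / 2 - x) * (cos c - cos d) =
    (cos c * x) * (pi / 2 - x) - x * (cos d * (pi / 2 - x)) by ring.
rewrite -cE -dE; lra.
Qed.

Definition expi (R : realType) (t : R) : R[i] := (cos t +i* sin t)%C.

(** Squared modulus with values in [R], whereas the norm of [R[i]] lives in [R[i]]. *)
Definition sqnormc (R : realType) (z : R[i]) : R :=
  complex.Re z ^+ 2 + complex.Im z ^+ 2.

Definition eval_expi (R : realType) (p : {poly R}) (t : R) : R[i] :=
  (map_poly (real_complex R) p).[expi t].

Lemma expiX (R : realType) (t : R) n : expi t ^+ n = expi (n%:R * t).
Proof.
elim: n => [|n IH]; first by rewrite expr0 mul0r /expi cos0 sin0.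
rewrite exprS IH -[n.+1]addn1 natrD mulrDl mul1r /expi cosD sinD.
by apply/eqP; rewrite eq_complex /=; apply/andP; split; apply/eqP; ring.
Qed.

Lemma sqnormcE (R : realType) (z : R[i]) : (sqnormc z)%:C%C = `|z| ^+ 2.
Proof. exact: add_Re2_Im2. Qed.

Lemma sqnormcM (R : realType) (z1 z2 : R[i]) :
  sqnormc (z1 * z2) = sqnormc z1 * sqnormc z2.
Proof. by apply: complexI; rewrite rmorphM /= !sqnormcE normrM exprMn. Qed.

Lemma sqnormcX (R : realType) (z : R[i]) n :
  sqnormc (z ^+ n) = sqnormc z ^+ n.
Proof. by apply: complexI; rewrite rmorphXn /= !sqnormcE normrX exprAC. Qed.

Lemma sqnormc_ge0 (R : realType) (z : R[i]) : 0 <= sqnormc z.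
Proof. by rewrite addr_ge0 ?sqr_ge0. Qed.

Lemma sqnormc_expi_sub1 (R : realType) (t : R) :
  sqnormc (expi t - 1) = 4 * sin (t / 2) ^+ 2.
Proof.
rewrite /sqnormc /= subr0.
have tE : t = (t / 2) *+ 2 by lra.
have := cos2Dsin2 t; have := cos2Dsin2 (t / 2).
have := cos_mulr2n (t / 2); rewrite -tE => ->.
by move=> h1 h2; nra.
Qed.

Lemma eval_expiE (R : realType) (p : {poly R}) (t : R) n :
  (size p <= n)%N ->
  eval_expi p t = ((\sum_(i < n) p`_i * cos (i%:R * t)) +i*
                   (\sum_(i < n) p`_i * sin (i%:R * t)))%C.
Proof.
move=> sz; rewrite /eval_expi (@horner_coef_wide _ n) ?size_map_poly //.
under eq_bigr => i _ do rewrite coef_map expiX /=.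
elim/big_rec3: _ => [//|i y1 y2 y3 _ ->].
by apply/eqP; rewrite eq_complex /=; apply/andP; split; apply/eqP; ring.
Qed.

(** At [t = 2 * pi * x] the double sum is half the derivative of [band_energy] in [x]. *)
Lemma sqnormc_eval_expi (R : realType) (p : {poly R}) (t : R) n :
  (size p <= n)%N ->
  sqnormc (eval_expi p t) =
  \sum_(i < n) \sum_(j < n) p`_i * p`_j * cos ((i%:R - j%:R) * t).
Proof.
move=> sz; rewrite (eval_expiE t sz) /sqnormc /= !expr2.
rewrite !big_distrl -big_split /=.
apply: eq_bigr => i _; rewrite !big_distrr -big_split /=.
by apply: eq_bigr => j _; rewrite mulrBl cosB; ring.
Qed.

(** Geometric sum: multiplied by [expi (2 * pi * x) - 1], it has modulus at most 2, while that
    factor has modulus [2 * sin (pi * x)], at least [4 * x] by Jordan. The bound is uniform in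
    [M]. *)
Lemma eval_expi_box_le (R : realType) M (x : R) : 0 < x <= 2^-1 ->
  sqnormc (eval_expi (\sum_(i < M) 'X^i) (2 * pi * x)) * (2 * x) ^+ 2 <= 1.
Proof.
case/andP=> x_gt0 x_le; set q := eval_expi _ _.
have pi0 := pi_gt0 R.
have qE : q = \sum_(i < M) expi (2 * pi * x) ^+ i.
  rewrite /q /eval_expi rmorph_sum horner_sum; apply: eq_bigr => i _.
  by rewrite /= map_polyXn hornerXn.
have : sqnormc ((expi (2 * pi * x) - 1) * q) <= 4.
  rewrite qE -subrX1 expiX sqnormc_expi_sub1.
  set s := sin _; have := sin_le1 (M%:R * (2 * pi * x) / 2).
  have := sin_geN1 (M%:R * (2 * pi * x) / 2); rewrite -/s => *; nra.
rewrite sqnormcM sqnormc_expi_sub1.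
have -> : 2 * pi * x / 2 = pi * x by lra.
have jordan : 2 * x <= sin (pi * x).
  rewrite -(ler_pM2l pi0).
  have -> : pi * (2 * x) = 2 * (pi * x) by ring.
  by apply: jordan_sin; rewrite ler_pM2l // x_le andbT mulr_ge0 // ltW.
have := sqnormc_ge0 q; set Q := sqnormc q => Q0 hQ.
have : (2 * x) ^+ 2 <= sin (pi * x) ^+ 2 by rewrite lerXn2r ?nnegrE; lra.
move=> h; have := ler_wpM2l Q0 h; lra.
Qed.

Lemma eval_expi_boxX_le (R : realType) M r (x : R) : 0 < x <= 2^-1 ->
  sqnormc (eval_expi ((\sum_(i < M) 'X^i) ^+ r) (2 * pi * x))
    * (2 * x) ^+ (2 * r) <= 1.
Proof.
move=> x_itv; rewrite /eval_expi rmorphXn horner_exp sqnormcX exprM -exprMn.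
apply: exprn_ile1; first by rewrite mulr_ge0 ?sqnormc_ge0 ?sqr_ge0.
exact: eval_expi_box_le.
Qed.

(** * Energy in a frequency band *)

(* The integral of [e^(2 pi i d f)] over [-x <= f <= x]. *)
Definition band_entry (R : realType) (d x : R) : R :=
  if d == 0 then 2 * x else sin (2 * pi * d * x) / (pi * d).

Definition band_energy (R : realType) n (v : 'I_n -> R) (x : R) : R :=
  \sum_(i < n) \sum_(j < n) v i * v j * band_entry (i%:R - j%:R) x.

Lemma is_derive_band_entry (R : realType) (d x : R) :
  is_derive x 1 (band_entry d) (2 * cos (d * (2 * pi * x))).
Proof.
have [->|d0] := eqVneq d 0.
  have -> : band_entry 0 = 2 \*: (@id R).
    by apply/funext => y; rewrite /band_entry eqxx.
  by apply: is_derive_eq; rewrite mul0r cos0.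
have -> : band_entry d = (pi * d)^-1 \*: (@sin R \o ((2 * pi * d) \*: @id R)).
  apply/funext => y; rewrite /band_entry (negPf d0) /=.
  by rewrite mulrC.
have pi0 : pi != 0 :> R by rewrite gt_eqF ?pi_gt0.
apply: is_derive_eq; rewrite /= /GRing.scale /=.
have -> : 2 * pi * d * x = d * (2 * pi * x) by ring.
by move: pi pi0 => p p0; field; rewrite p0 d0.
Qed.

Lemma is_derive_band_energy (R : realType) n (v : 'I_n -> R) (x : R) :
  is_derive x 1 (band_energy v)
    (2 * \sum_(i < n) \sum_(j < n)
           v i * v j * cos ((i%:R - j%:R) * (2 * pi * x))).
Proof.
have -> : band_energy v =
    \sum_(i < n) \sum_(j < n) (v i * v j) \*: band_entry (i%:R - j%:R).
  apply/funext => y; rewrite /band_energy fct_sumE; apply: eq_bigr => i _.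
  by rewrite fct_sumE.
apply: is_derive_eq.
  apply: is_derive_sum => i; apply: is_derive_sum => j; apply: is_deriveZ.
  exact: is_derive_band_entry.
rewrite mulr_sumr; apply: eq_bigr => i _.
rewrite mulr_sumr; apply: eq_bigr => j _.
by rewrite /GRing.scale /=; ring.
Qed.

(** Provides the primitive against which the growth of the band energy is compared. *)
Lemma is_derive_opp_exprV (R : realType) k (x : R) : 0 < x ->
  is_derive x 1 (fun y : R => - ((2 * y)^-1 ^+ k.+1))
    (2 * k.+1%:R * (2 * x)^-1 ^+ k.+2).
Proof.
move=> x0.
have d2 : is_derive x 1 (fun y : R => (2 * y)^-1) (- (2 * x) ^- 2 *: 2).
  have d1 : is_derive x 1 (2 \*: @id R) 2.
    by apply: is_derive_eq; rewrite /GRing.scale /= mulr1.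
  by apply: (is_deriveV _ d1); rewrite mulf_neq0 ?gt_eqF.
have -> : (fun y : R => - ((2 * y)^-1 ^+ k.+1)) =
    - ((fun y : R => (2 * y)^-1) ^+ k.+1).
  by apply/funext => y; rewrite fctE exprfctE.
apply: is_derive_eq; rewrite /GRing.scale /= -exprVn !exprS.
ring.
Qed.

(* Integrating the pointwise bound [(2 x)^-(k+2)] on the spectral density over
   [W <= |x| <= 1/2], in the form of a comparison of primitives. *)
Lemma band_energy_tail (R : realType) n (v : 'I_n -> R) k (W : R) :
  0 < W <= 2^-1 ->
  (forall x, 0 < x <= 2^-1 ->
    (\sum_(i < n) \sum_(j < n) v i * v j * cos ((i%:R - j%:R) * (2 * pi * x)))
      * (2 * x) ^+ k.+2 <= 1) ->
  band_energy v 2^-1 - band_energy v W <= (2 * W)^-1 ^+ k.+1.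
Proof.
case/andP=> W0 W_le decay.
pose H y := - ((2 * y)^-1 ^+ k.+1) : R.
pose dF y := 2 * k.+1%:R * (2 * y)^-1 ^+ k.+2 -
  2 * \sum_(i < n) \sum_(j < n) v i * v j * cos ((i%:R - j%:R) * (2 * pi * y)).
have dFP y : y \in `[W, 2^-1]%R -> is_derive y 1 (H - band_energy v) (dF y).
  rewrite in_itv /= => /andP[Wy _]; apply: is_deriveB.
    exact/is_derive_opp_exprV/(lt_le_trans W0).
  exact: is_derive_band_energy.
have cont : {within `[W, 2^-1], continuous (H - band_energy v)}.
  by apply: derivable_within_continuous => y /dFP [].
have dFP' y : y \in `]W, 2^-1[%R -> is_derive y 1 (H - band_energy v) (dF y).
  by move=> y_itv; apply: dFP; apply: subset_itv_oo_cc.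
have [c c_itv] := MVT_segment W_le dFP' cont.
move: c_itv; rewrite in_itv /= => /andP[Wc c_le].
have c0 : 0 < c by apply: lt_le_trans Wc.
(* The decay hypothesis, with the factor [k.+1 >= 1] to spare. *)
have dF_ge0 : 0 <= dF c.
  have := decay c; rewrite c0 c_le => /(_ isT).
  rewrite -ler_pdivlMr ?exprn_gt0 ?mulr_gt0 // div1r /dF => h.
  rewrite exprVn -mulrA -mulrBr mulr_ge0 // subr_ge0 (le_trans h) //.
  by rewrite ler_peMl ?invr_ge0 ?exprn_ge0 ?mulr_ge0 ?(ltW c0) // ler1n.
have HE y : (H - band_energy v) y = H y - band_energy v y by [].
rewrite !HE => FE.
have : 0 <= dF c * (2^-1 - W) by rewrite mulr_ge0 // subr_ge0.
(* [H 2^-1 = -1], so the increment of [H] is the claimed bound minus 1. *)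
rewrite -FE /H divff // invr1 expr1n; lra.
Qed.

(** * Full-band energy and the DPSS kernel *)

Lemma sin_natpi (R : realType) (k : nat) : sin (pi * k%:R) = 0 :> R.
Proof.
elim: k => [|k IH]; first by rewrite mulr0 sin0.
by rewrite -[k.+1]addn1 natrD mulrDr mulr1 sinDpi IH oppr0.
Qed.

Lemma sin_natBpi (R : realType) (m n : nat) :
  sin (pi * (m%:R - n%:R)) = 0 :> R.
Proof. by rewrite mulrBr sinB !sin_natpi mul0r mulr0 subrr. Qed.

(** Parseval: over a full period the exponentials are orthonormal. *)
Lemma band_energy_half (R : realType) n (v : 'I_n -> R) :
  band_energy v 2^-1 = \sum_(i < n) v i ^+ 2.
Proof.
apply: eq_bigr => i _; rewrite (bigD1 i) //= big1 => [|j ji].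
  by rewrite subrr /band_entry eqxx divff // mulr1 addr0 expr2.
rewrite /band_entry subr_eq0 eqr_nat ifN; last by rewrite eq_sym.
have -> : 2 * pi * (i%:R - j%:R) * 2^-1 = pi * (i%:R - j%:R) :> R.
  by move: pi => p; field.
by rewrite sin_natBpi mul0r mulr0.
Qed.

Lemma band_energy_dpss (R : realType) n K (v : 'rV[R]_n) :
  (v *m dpss_kernel R n K *m v^T) 0 0 =
  band_energy (v 0) ((2 * K + 1)%:R / n%:R / 2).
Proof.
rewrite mxE /band_energy exchange_big; apply: eq_bigr => j _ /=.
rewrite !mxE big_distrl; apply: eq_bigr => i _ /=; rewrite mxE mulrAC.
have n0 : n%:R != 0 :> R by case: (n) i => [[]//|k _]; rewrite pnatr_eq0.
congr (_ * _); rewrite /band_entry subr_eq0 eqr_nat.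
case: eqVneq => [->|ij]; last first.
  have /negPf -> : (i : nat) != j by [].
  by congr (sin _ / _); move: pi => p; field.
by rewrite eqxx mulrCA divff // mulr1.
Qed.

Lemma dpss_kernel_sym (R : realType) n K :
  (dpss_kernel R n K)^T = dpss_kernel R n K.
Proof.
apply/matrixP => i j; rewrite !mxE eq_sym; case: eqVneq => // ij.
by rewrite -opprB !mulrN !mulNr sinN invrN mulrNN.
Qed.

(** * A concentrated test vector *)

Lemma sqr_sum_le (R : realFieldType) n (v : 'I_n -> R) :
  (\sum_i v i) ^+ 2 <= n%:R * \sum_i v i ^+ 2.
Proof.
case: n v => [|n] v; first by rewrite !big_ord0 expr0n mulr0.
set S := \sum_i v i; set T := \sum_i _; set N : R := n.+1%:R.
have N0 : 0 < N by rewrite ltr0n.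
(* Cauchy-Schwarz against the all-ones vector, from the nonnegativity of a variance. *)
have : 0 <= \sum_i (N * v i - S) ^+ 2 by apply: sumr_ge0 => i _; exact: sqr_ge0.
have -> : \sum_i (N * v i - S) ^+ 2 = N * (N * T - S ^+ 2).
  under eq_bigr => i _.
    rewrite (_ : _ ^+ 2 = N ^+ 2 * v i ^+ 2 - 2 * N * S * v i + S ^+ 2);
      last by ring.
    over.
  rewrite big_split sumrB /= -!mulr_sumr sumr_const card_ord -mulr_natl.
  rewrite -/S -/T -/N.
  by ring.
by rewrite pmulr_rge0 // subr_ge0.
Qed.

(* The test vector is the discrete B-spline of order [r], the coefficient
   sequence of [(1 + X + ... + X^(M-1))^r]. *)
Lemma dpss_kernel_eigenvalue (R : realType) (r M K : nat) :
  (0 < r)%N -> (0 < M)%N -> (2 * K + 1 <= r * M)%N ->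
  exists2 lam : R, eigenvalue (dpss_kernel R (r * M) K) lam
    & 1 - r%:R ^+ (2 * r) / (2 * K + 1)%:R ^+ (2 * r).-1 <= lam.
Proof.
move=> r0 M0 B_le.
pose p : {poly R} := (\sum_(i < M) 'X^i) ^+ r.
pose N := (r * M)%N; pose v : 'rV[R]_N := \row_i p`_i.
(* The degree is at most [r * (M - 1)], which is below [r * M] as [r > 0]. *)
have sz : (size p <= N)%N.
  have szq : (size (\sum_(i < M) 'X^i : {poly R})%R <= M)%N.
    apply: (leq_trans (size_sum _ _ _)); apply/bigmax_leqP => i _.
    by rewrite size_polyXn.
  apply: (leq_trans (size_poly_exp_leq _ _)); rewrite /N; nia.
have N0 : 0 < N%:R :> R by rewrite ltr0n muln_gt0 r0.
have B0 : 0 < (2 * K + 1)%:R :> R by rewrite ltr0n addn1.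
pose T := \sum_i v 0 i ^+ 2.
have T_ge : M%:R ^+ (2 * r) <= N%:R * T.
  (* The coefficients sum to [p.[1]], that is [M ^ r]. *)
  have <- : (\sum_i v 0 i) ^+ 2 = M%:R ^+ (2 * r).
    have -> : \sum_i v 0 i = p.[1].
      rewrite (horner_coef_wide _ sz); apply: eq_bigr => i _.
      by rewrite mxE expr1n mulr1.
    rewrite /p horner_exp horner_sum mulnC exprM.
    under eq_bigr do rewrite hornerXn expr1n.
    by rewrite sumr_const card_ord.
  exact: sqr_sum_le.
have T_gt0 : 0 < T.
  by rewrite -(pmulr_rgt0 _ N0) (lt_le_trans _ T_ge) // exprn_gt0 // ltr0n.
pose W : R := (2 * K + 1)%:R / N%:R / 2.
have W2 : 2 * W = (2 * K + 1)%:R / N%:R by rewrite /W; field; rewrite gt_eqF.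
have W_itv : 0 < W <= 2^-1.
  rewrite !divr_gt0 //= ler_pdivrMr // mulVf // ler_pdivrMr // mul1r.
  by rewrite ler_nat.
have tail : T - band_energy (v 0) W <= (2 * W)^-1 ^+ (2 * r).-1.
  rewrite /T -band_energy_half.
  have -> : (2 * r).-1 = (2 * r.-1).+1 by lia.
  apply: band_energy_tail => // x x_itv.
  under eq_bigr => i _ do under eq_bigr => j _ do rewrite !mxE.
  rewrite -(sqnormc_eval_expi _ sz).
  have -> : (2 * r.-1).+2 = (2 * r)%N by lia.
  exact: eval_expi_boxX_le.
have vT : (v *m v^T) 0 0 = T.
  by rewrite mxE; apply: eq_bigr => i _; rewrite !mxE expr2.
apply: (symmetric_rayleigh_eigenvalue (v := v)).
- exact: dpss_kernel_sym.
- apply: contraTneq T_gt0 => v0; rewrite /T v0 big1 ?ltxx // => i _.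
  by rewrite mxE expr0n.
rewrite band_energy_dpss -/N -/W vT mulrBl mul1r lerBlDr -lerBlDl.
apply: (le_trans tail); rewrite W2 invf_div expr_div_n mulrAC.
rewrite ler_pM2r ?invr_gt0 ?exprn_gt0 //.
(* Multiplying by [N] makes the left side [N ^ (2 r) = r ^ (2 r) * M ^ (2 r)], to which [T_ge]
   applies. *)
rewrite -(ler_pM2l N0) -exprS prednK ?muln_gt0 //.
rewrite [leLHS](_ : _ = r%:R ^+ (2 * r) * M%:R ^+ (2 * r));
  last by rewrite -exprMn -natrM.
by rewrite mulrCA ler_pM2l ?exprn_gt0 ?ltr0n.
Qed.

(** * The choice of parameters *)

Lemma paramA_ge (R : realType) (eps : R) : 0 < eps < 1 ->
  175 * (1 - ln eps) ^+ 2 <= (paramA eps)%:R.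
Proof.
case/andP => e0 e1; have lne := ln_lt0 (introT andP (conj e0 e1)).
have ln10 : 0 <= ln (10 : R) by apply: ln_ge0; lra.
apply: (@le_trans _ _ (175 * (ln (10 / eps) + 1) ^+ 2)).
  rewrite ln_div ?posrE // ler_wpM2l // lerXn2r ?nnegrE; lra.
rewrite /paramA; set y := 175 * _.
have y0 : 0 <= y by rewrite mulr_ge0 ?sqr_ge0.
have c0 : 0 <= Num.ceil y by rewrite ceil_ge0 (lt_le_trans _ y0).
by rewrite natr_absz ger0_norm // ceil_ge.
Qed.

(** Invert [expR (- 2^-1) >= 1 - 2^-1]. *)
Lemma expR_half_le2 (R : realType) : expR (2^-1) <= 2 :> R.
Proof.
have := expR_ge1Dx (- 2^-1 : R); rewrite expRN => h.
rewrite -[leRHS]invrK -[leLHS]invrK lef_pV2 ?posrE ?invr_gt0 ?expR_gt0 //; lra.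
Qed.

(** The quadratic lower bound on [paramA] gives [- ln eps <= (r - 1) / 2]; exponentiate and bound
    [expR (2^-1)] by 2. *)
Lemma pow2_paramA_ge (R : realType) (eps : R) (r : nat) : 0 < eps < 1 ->
  (paramA eps < 2 * r)%N -> eps^-1 <= 2 ^+ r.-1.
Proof.
move=> e01 Ar; have := paramA_ge e01; case/andP: e01 => e0 e1.
have lne := ln_lt0 (introT andP (conj e0 e1)) => A_ge.
have r_ge : (paramA eps)%:R + 1 <= 2 * r%:R :> R.
  by rewrite -natrM natr1 ler_nat.
have r0 : (0 < r)%N by lia.
rewrite -[eps in leLHS]lnK ?posrE // -expRN.
apply: (@le_trans _ _ (expR (2^-1 * r.-1%:R))).
  rewrite ler_expR; have : r.-1%:R + 1 = r%:R :> R by rewrite natr1 prednK.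
  move: (ln eps) lne A_ge => y; move: (r.-1%:R) => s *; nra.
by rewrite expRM_natr lerXn2r ?nnegrE ?expR_ge0 // expR_half_le2.
Qed.

Theorem theorem2 (R : realType) (eps : R) (l : nat) :
  0 < eps < 1 ->
  let m := param_m eps in
  let N := (2 ^ (l + m))%N in
  let K := (2 ^ (m - 1) - 1)%N in
  exists2 lam : R, eigenvalue (dpss_kernel R N K) lam & 1 - eps <= lam.
Proof.
move=> e01; rewrite /param_m /=.
have A_lt : (paramA eps < 2 ^ up_log 2 (paramA eps).+1)%N by exact: up_logP.
have A_gt0 : (0 < paramA eps)%N.
  rewrite -(ltr_nat R) (lt_le_trans _ (paramA_ge e01)) //.
  case/andP: e01 => e0 e1; have := ln_lt0 (introT andP (conj e0 e1)); nra.
move: A_lt; set u := up_log _ _ => A_lt.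
(* Since [2 ^ u > paramA eps >= 1], [u] is positive, so [m - 2 = k] is a genuine natural number. *)
have [k uE] : exists k, u = k.+1.
  by move: A_lt; case: u => [|k _]; [lia | exists k].
rewrite {}uE in A_lt * => {u}.
pose r := (2 ^ k)%N; pose M := (2 ^ l.+2)%N.
have r0 : (0 < r)%N by rewrite expn_gt0.
have NE : (2 ^ (l + k.+2) = r * M)%N by rewrite -expnD; congr (2 ^ _)%N; lia.
have KE : (2 ^ (k.+2 - 1) - 1 = 2 * r - 1)%N by rewrite subSS subn0 expnS.
rewrite NE KE.
have [||lam eig lam_ge] := @dpss_kernel_eigenvalue R r M (2 * r - 1) r0.
- by rewrite expn_gt0.
(* Here [2 * K + 1 = 4 * r - 1], so [M >= 4] keeps the band within a full period. *)
- have : (4 <= M)%N by rewrite /M !expnS; have := expn_gt0 2 l; lia.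
  nia.
exists lam => //; apply: le_trans lam_ge; rewrite lerD2l lerN2.
have B_ge : (2 * r)%:R <= (2 * (2 * r - 1) + 1)%:R :> R by rewrite ler_nat; lia.
have e0 : 0 < eps by case/andP: e01.
have r_gt0 : 0 < r%:R :> R by rewrite ltr0n.
(* Weakening [4 * r - 1] to [2 * r] collapses the loss to [r / 2 ^ (2 r - 1)], the product of
   [r / 2 ^ r <= 1] and [1 / 2 ^ (r - 1) <= eps]. *)
apply: (@le_trans _ _ (r%:R ^+ (2 * r) / (2 * r)%:R ^+ (2 * r).-1)).
  rewrite ler_wpM2l ?exprn_ge0 // lef_pV2 ?posrE ?exprn_gt0 ?ltr0n //; try lia.
  by rewrite lerXn2r ?nnegrE.
have r_lt : r%:R <= 2 ^+ r :> R by rewrite -natrX ler_nat ltnW // ltn_expl.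
have pow_ge := pow2_paramA_ge e01 (r := r) _.
have {pow_ge} : eps^-1 <= 2 ^+ r.-1.
  by apply: pow_ge; rewrite -expnS.
rewrite -[leLHS]mul1r ler_pdivrMr // => pow_ge.
rewrite ler_pdivrMr ?exprn_gt0 ?ltr0n ?muln_gt0 ?r0 //.
rewrite natrM exprMn.
have -> : (2 * r)%N = (2 * r).-1.+1 by lia.
rewrite exprS /= mulrA ler_pM2r ?exprn_gt0 //.
apply: (le_trans r_lt).
have -> : (2 * r).-1 = (r + r.-1)%N by lia.
rewrite exprD mulrCA ler_peMr ?exprn_ge0 //.
by rewrite mulrC.
Qed.
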